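(* Let $A$ be a Banach algebra. Then: (1) If $\tilde{Z}_1^\ell(A^{**})=A$, then $A$ is a right ideal in $A^{**}$. (2) If $\tilde{Z}_1^r(A^{**})=A$, then $A$ is a left ideal in $A^{**}$. (3) If $\tilde{Z}_1^\ell(A^{**})=\tilde{Z}_1^r(A^{**})=A$, then $A$ is an ideal in $A^{**}$.
   Context: $A^*,A^{**},A^{***}$ denote the successive duals of $A$; $A$ is regarded as a subspace of $A^{**}$ via the canonical embedding. $A^{**}$ carries the first Arens product: for $a,b\in A$, $a'\in A^*$, $a'',b''\in A^{**}$, $\langle a'a,b\rangle=\langle a',ab\rangle$, $\langle a''a',a\rangle=\langle a'',a'a\rangle$, $\langle a''b'',a'\rangle=\langle a'',b''a'\rangle$. On $A^{**}$, weak$^*$ means $\sigma(A^{**},A^* )$ and weak means $\sigma(A^{**},A^{***})$. $\tilde Z_1^\ell(A^{**})=\{a''\in A^{**}: b''\mapsto a''b'' \text{ is weak}^*\text{-to-weak continuous on }A^{**}\}$. $\tilde Z_1^r(A^{**})=\{a''\in A^{**}: b''\mapsto b''a'' \text{ is weak}^*\text{-to-weak continuous on }A^{**}\}$. *)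

(* Defs.v *)
From HB Require Import structures.
From mathcomp Require Import all_boot all_order all_algebra.
From mathcomp Require Import all_classical all_reals topology normedtype.
From mathcomp Require Import complex.

Set Implicit Arguments.
Unset Strict Implicit.
Unset Printing Implicit Defensive.

Import Order.TTheory GRing.Theory Num.Theory.
Import numFieldNormedType.Exports.

Local Open Scope classical_set_scope.
Local Open Scope ring_scope.

(* A Banach algebra is real or complex; both cases are treated at once. *)
Variant scalars := RealScalars | ComplexScalars.

Definition scalar_field (R : realType) (s : scalars) : numFieldType :=
  match s with RealScalars => R | ComplexScalars => R[i] end.

(* Norms on a module over [K : numFieldType] take their values in [K], while *)
(* suprema are only available in [R]: this is the inclusion of R in K.       *)
Definition of_real (R : realType) (s : scalars) : R -> scalar_field R s :=
  match s with RealScalars => id | ComplexScalars => real_complex R end.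

(* Banach algebras are not assumed to be unital, hence do not fit the ring   *)
(* structures of the library.                                                *)
HB.mixin Record CompleteNormedModule_isBanachAlgebra (K : numFieldType) A
    & CompleteNormedModule K A := {
  bmul : A -> A -> A;
  bmulA : associative bmul;
  bmulDl : left_distributive bmul +%R;
  bmulDr : right_distributive bmul +%R;
  bmulZl : forall (k : K) (a b : A), bmul (k *: a) b = k *: bmul a b;
  bmulZr : forall (k : K) (a b : A), bmul a (k *: b) = k *: bmul a b;
  ler_norm_bmul : forall a b : A, `|bmul a b| <= `|a| * `|b|
}.

#[short(type="banachAlgType")]
HB.structure Definition BanachAlgebra (K : numFieldType) :=
  {A of CompleteNormedModule_isBanachAlgebra K A & CompleteNormedModule K A}.

Section scalars.
Context {R : realType} {s : scalars}.
Local Notation K := (scalar_field R s).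
Local Notation "x %:K" := (of_real s x : K) (at level 2, format "x %:K").

Lemma of_realD : {morph @of_real R s : x y / x + y}.
Proof. by case: s => //= x y; rewrite rmorphD. Qed.

Lemma of_realM : {morph @of_real R s : x y / x * y}.
Proof. by case: s => //= x y; rewrite rmorphM. Qed.

Lemma of_real0 : (0 : R)%:K = 0.
Proof. by case: s. Qed.

Lemma ler_of_real : {mono @of_real R s : x y / x <= y}.
Proof. by case: s => //= x y; rewrite lecR. Qed.

Lemma of_real_inj : injective (@of_real R s).
Proof. by case: s => /=; [exact: inj_id|exact: complexI]. Qed.

Lemma ge0_of_real (k : K) : 0 <= k -> exists2 x : R, 0 <= x & k = x%:K.
Proof.
case: s k => /= [k k0|[a b]]; first by exists k.
by rewrite lecE/= => /andP[/eqP -> a0]; exists a.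
Qed.

End scalars.

Section dual.
Context {R : realType} {s : scalars}.
Local Notation K := (scalar_field R s).
Local Notation "x %:K" := (of_real s x : K) (at level 2, format "x %:K").
Variable V : normedModType K.

Definition continuous_linear_functional : {pred V -> K^o} :=
  [pred f : V -> K^o | `[< linear f /\ continuous f >]].

Record dual := Dual {
  dual_fun :> V -> K^o;
  dual_funP : dual_fun \in continuous_linear_functional }.

HB.instance Definition _ := [isSub for dual_fun].
HB.instance Definition _ := [Choice of dual by <:].

Lemma continuous_linear_functional_submod :
  submod_closed continuous_linear_functional.
Proof.
split=> [|k f g].
  apply/asboolP; split => [k x y|]; last exact: cst_continuous.
  by rewrite /= scaler0 addr0.
move=> /asboolP[lf cf] /asboolP[lg cg]; apply/asboolP; split => [l x y|x].
  rewrite !fctE lf lg !scalerDr !scalerA [l * k]mulrC.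
  by rewrite -!addrA; congr (_ + _); rewrite addrCA.
by apply: cvgD; [apply: cvgZr; exact: cf|exact: cg].
Qed.

HB.instance Definition _ := GRing.isSubmodClosed.Build K (V -> K^o)
  continuous_linear_functional continuous_linear_functional_submod.

HB.instance Definition _ := [SubChoice_isSubLmodule of dual by <:].

Lemma dual_linear (f : dual) : linear f.
Proof. by have /asboolP[] := dual_funP f. Qed.

HB.instance Definition _ (f : dual) :=
  GRing.isLinear.Build K V K^o *:%R f (dual_linear f).

Lemma dual_continuous (f : dual) : continuous (f : V -> K^o).
Proof. by have /asboolP[] := dual_funP f. Qed.

Lemma dual_eqP (f g : dual) : (forall x, f x = g x) -> f = g.
Proof. by move=> fg; apply/val_inj/funext. Qed.

Lemma dualDE (f g : dual) x : (f + g) x = f x + g x.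
Proof. by []. Qed.

Lemma dualZE k (f : dual) x : (k *: f) x = k *: f x.
Proof. by []. Qed.

Lemma dual_bounded (f : dual) :
  exists2 M : R, 0 <= M & forall x, `|f x| <= M%:K * `|x|.
Proof.
have /linear_boundedP/pinfty_ex_gt0[r r0 fr] :=
  continuous_linear_bounded 0 (@dual_continuous f 0).
by have [M M0 rM] := ge0_of_real (ltW r0); exists M => // x; rewrite -rM fr.
Qed.

Lemma bounded_dual (f : V -> K^o) : linear f ->
    (exists M : K, forall x, `|f x| <= M * `|x|) ->
  f \in continuous_linear_functional.
Proof.
move=> lf [M fM]; apply/asboolP; split => //.
pose g : {linear V -> K^o} :=
  HB.pack f (GRing.isLinear.Build K V K^o *:%R f lf).
apply: (@bounded_linear_continuous _ _ _ g); apply/bounded_funP => r.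
exists (`|M| * r) => x xr; have [/eqP x0|x0] := eqVneq x 0.
  by rewrite (eqP x0) linear0 normr0 mulr_ge0// (le_trans _ xr).
have M0 : 0 <= M.
  by rewrite -(pmulr_lge0 _ (_ : 0 < `|x|)) ?normr_gt0// (le_trans _ (fM x)).
by rewrite (le_trans (fM x))// ger0_norm// ler_wpM2l.
Qed.

(* The operator norm, i.e., the supremum of |f x| over the unit ball. *)
Definition dual_norm (f : dual) : K :=
  (sup [set r : R | exists2 x : V, `|x| <= 1 & `|f x| = r%:K])%:K.

Lemma dual_norm_has_sup (f : dual) :
  has_sup [set r : R | exists2 x : V, `|x| <= 1 & `|f x| = r%:K].
Proof.
split.
  by exists 0; exists 0; rewrite ?linear0 ?normr0 ?ler01// of_real0.
have [M M0 fM] := dual_bounded f; exists M => r [x x1 fxr].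
rewrite -(ler_of_real (s := s)) -fxr (le_trans (fM x))//.
by rewrite ler_piMr// -of_real0 ler_of_real.
Qed.

Lemma dual_norm_ge0 (f : dual) : 0 <= dual_norm f.
Proof.
rewrite -of_real0 ler_of_real; apply: ub_le_sup.
  by have [] := dual_norm_has_sup f.
by exists 0; rewrite ?linear0 ?normr0 ?ler01// of_real0.
Qed.

Lemma ler_dual_norm (f : dual) x : `|f x| <= dual_norm f * `|x|.
Proof.
have [->|x0] := eqVneq x 0; first by rewrite linear0 !normr0 mulr0.
have nx0 : 0 < `|x| by rewrite normr_gt0.
rewrite -ler_pdivrMr//.
have [r r0 rE] := ge0_of_real (divr_ge0 (normr_ge0 (f x)) (normr_ge0 x)).
rewrite rE ler_of_real; apply: ub_le_sup.
  by have [] := dual_norm_has_sup f.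
exists (`|x|^-1 *: x).
  by rewrite normrZ normfV normr_id mulVf// gt_eqF.
by rewrite linearZ/= normrZ normfV normr_id mulrC.
Qed.

Lemma dual_norm_le (f : dual) (M : K) :
  0 <= M -> (forall x, `|f x| <= M * `|x|) -> dual_norm f <= M.
Proof.
move=> /ge0_of_real[m m0 ->] fm; rewrite ler_of_real; apply: ge_sup.
  by have [] := dual_norm_has_sup f.
move=> r [x x1 fxr]; rewrite -(ler_of_real (s := s)) -fxr.
by rewrite (le_trans (fm x))// ler_piMr// -of_real0 ler_of_real.
Qed.

Lemma dual_normD (f g : dual) :
  dual_norm (f + g) <= dual_norm f + dual_norm g.
Proof.
apply: dual_norm_le => [|x]; first by rewrite addr_ge0// dual_norm_ge0.
by rewrite mulrDl (le_trans (ler_normD _ _))// lerD// ler_dual_norm.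
Qed.

Lemma dual_normZ_le (k : K) (f : dual) :
  dual_norm (k *: f) <= `|k| * dual_norm f.
Proof.
apply: dual_norm_le => [|x]; first by rewrite mulr_ge0// dual_norm_ge0.
by rewrite dualZE normrZ -mulrA ler_wpM2l// ler_dual_norm.
Qed.

Lemma dual_normZ (k : K) (f : dual) :
  dual_norm (k *: f) = `|k| * dual_norm f.
Proof.
apply/eqP; rewrite eq_le dual_normZ_le/=.
have [->|k0] := eqVneq k 0; first by rewrite normr0 mul0r dual_norm_ge0.
rewrite -ler_pdivlMl ?normr_gt0//.
by rewrite -{1}[f](scalerK k0) -normfV dual_normZ_le.
Qed.

Lemma dual_norm0_eq0 (f : dual) : dual_norm f = 0 -> f = 0.
Proof.
move=> f0; apply: dual_eqP => x; apply/eqP; rewrite -normr_le0.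
by rewrite (le_trans (ler_dual_norm f x))// f0 mul0r.
Qed.

HB.instance Definition _ := Lmodule_isNormed.Build K dual
  dual_normD dual_normZ dual_norm0_eq0.

Lemma dual_normE (f : dual) : `|f| = dual_norm f.
Proof. by []. Qed.

Lemma ler_norm_dual (f : dual) x : `|f x| <= `|f| * `|x|.
Proof. exact: ler_dual_norm. Qed.

Lemma norm_dual_le (f : dual) (M : K) :
  0 <= M -> (forall x, `|f x| <= M * `|x|) -> `|f| <= M.
Proof. exact: dual_norm_le. Qed.

End dual.

Section bidual.
Context {R : realType} {s : scalars}.
Local Notation K := (scalar_field R s).
Variable V : normedModType K.

Lemma canonical_embedding_subproof (x : V) :
  (fun f : dual V => f x : K^o) \in @continuous_linear_functional R s (dual V).
Proof.
apply: bounded_dual => [k f g //|]; exists `|x| => f.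
by rewrite mulrC ler_norm_dual.
Qed.

Definition canonical_embedding (x : V) : dual (dual V) :=
  Dual (canonical_embedding_subproof x).

(* sigma(V^*, V) on the dual of [V], and sigma(V, V^* ) on [V] *)
Definition weak_star : Type :=
  initial_topology (fun F : dual V => (F : {ptws V -> K})).
HB.instance Definition _ := Topological.on weak_star.

Definition weak : Type :=
  initial_topology (fun x : V => (canonical_embedding x : {ptws dual V -> K})).
HB.instance Definition _ := Topological.on weak.

End bidual.

Section arens.
Context {R : realType} {s : scalars}.
Local Notation K := (scalar_field R s).
Variable A : banachAlgType K.

Lemma dual_act_subproof (f : dual A) (a : A) :
  (fun b : A => f (bmul a b)) \in @continuous_linear_functional R s A.
Proof.
apply: bounded_dual => [k b c|].
  by rewrite bmulDr bmulZr linearP.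
exists (`|f| * `|a|) => b; rewrite -mulrA /=.
by rewrite (le_trans (ler_norm_dual _ _))// ler_wpM2l// ler_norm_bmul.
Qed.

(* <f a, b> = <f, a b> *)
Definition dual_act (f : dual A) (a : A) : dual A :=
  Dual (dual_act_subproof f a).

Lemma bidual_act_subproof (F : dual (dual A)) (f : dual A) :
  (fun a : A => F (dual_act f a)) \in @continuous_linear_functional R s A.
Proof.
apply: bounded_dual => [k a b|].
  rewrite -linearP; congr (F _); apply: dual_eqP => c.
  by rewrite dualDE dualZE/= bmulDl bmulZl linearP.
exists (`|F| * `|f|) => a; rewrite -mulrA.
rewrite (le_trans (ler_norm_dual _ _))// ler_wpM2l//.
apply: norm_dual_le => [|b]; first by rewrite mulr_ge0.
by rewrite -mulrA /= (le_trans (ler_norm_dual _ _))// ler_wpM2l// ler_norm_bmul.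
Qed.

(* <F f, a> = <F, f a> *)
Definition bidual_act (F : dual (dual A)) (f : dual A) : dual A :=
  Dual (bidual_act_subproof F f).

Lemma arens_subproof (F G : dual (dual A)) :
  (fun f : dual A => F (bidual_act G f))
    \in @continuous_linear_functional R s (dual A).
Proof.
apply: bounded_dual => [k f g|].
  rewrite -linearP; congr (F _); apply: dual_eqP => a.
  rewrite dualDE dualZE/= -linearP; congr (G _); exact: dual_eqP.
exists (`|F| * `|G|) => f; rewrite -mulrA.
rewrite (le_trans (ler_norm_dual _ _))// ler_wpM2l//.
apply: norm_dual_le => [|a]; first by rewrite mulr_ge0.
rewrite -mulrA /= (le_trans (ler_norm_dual _ _))// ler_wpM2l//.
apply: norm_dual_le => [|b]; first by rewrite mulr_ge0.
by rewrite -mulrA /= (le_trans (ler_norm_dual _ _))// ler_wpM2l// ler_norm_bmul.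
Qed.

(* First Arens product: <F G, f> = <F, G f> *)
Definition arens (F G : dual (dual A)) : dual (dual A) :=
  Dual (arens_subproof F G).

Definition wstar_to_weak_continuous
    (T : dual (dual A) -> dual (dual A)) :=
  continuous (T : weak_star (dual A) -> weak (dual (dual A))).

Definition left_wstar_weak_center : set (dual (dual A)) :=
  [set F | wstar_to_weak_continuous (fun G => arens F G)].

Definition right_wstar_weak_center : set (dual (dual A)) :=
  [set F | wstar_to_weak_continuous (fun G => arens G F)].

(* [A] regarded as a subspace of its bidual *)
Definition embedded : set (dual (dual A)) :=
  range (@canonical_embedding R s A).

Definition is_subspace (I : set (dual (dual A))) :=
  I 0 /\ forall (k : K) F G, I F -> I G -> I (k *: F + G).

Definition is_right_ideal (I : set (dual (dual A))) :=
  is_subspace I /\ forall F G, I F -> I (arens F G).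

Definition is_left_ideal (I : set (dual (dual A))) :=
  is_subspace I /\ forall F G, I F -> I (arens G F).

Definition is_ideal (I : set (dual (dual A))) :=
  is_left_ideal I /\ is_right_ideal I.

End arens.

Arguments left_wstar_weak_center {R s} A _.
Arguments right_wstar_weak_center {R s} A _.
Arguments embedded {R s} A _.

(* Main.v *)
Require Import Defs.
From mathcomp Require Import all_boot all_order all_algebra.
From mathcomp Require Import all_classical all_reals topology normedtype.
From mathcomp Require Import complex ring lra.

Set Implicit Arguments.
Unset Strict Implicit.
Unset Printing Implicit Defensive.

Import Order.TTheory GRing.Theory Num.Theory.
Import numFieldNormedType.Exports.

Local Open Scope classical_set_scope.
Local Open Scope ring_scope.

(** Let T be one of the maps G |-> F G or G |-> G F, with F in A.  It sends A
    into A, and by hypothesis it is continuous from the weak* to the weak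
    topology of the bidual; the claim is that it sends the whole bidual into A
    ([wstar_weak_into_embedded]).

    If a functional phi of A*** vanishes on A, then phi o T is weak*-continuous
    and vanishes on A, which is weak*-dense in its bidual, so phi o T = 0
    ([wstar_continuous_eq0]).  Density is used in a form without norm control:
    over any finite set of functionals, an element of the bidual is the
    evaluation at a vector ([bidual_interpolation]).  Hence every T F is
    annihilated by all functionals vanishing on A.  By the Hahn-Banach theorem
    ([exists_dual_dist]) its distance to A is zero.  Since A is complete and
    embeds isometrically ([norm_canonical_embedding], again by Hahn-Banach), A
    is closed in its bidual and T F lies in A ([dist_canonical_embedding_eq0]).

    The Hahn-Banach theorem is obtained without extending functionals from
    subspaces: a minimal sublinear functional, which exists by Zorn's lemma, is
    additive ([minimal_sublinear_additive]).  This yields a real-linear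
    functional, which over the complex numbers is the real part of a
    complex-linear one ([exists_linear_real_part]). *)

(** * Sublinear functionals and the Hahn-Banach theorem *)

Section hahn_banach.
Context {R : realType} {s : scalars}.
Local Notation K := (scalar_field R s).
Local Notation "x %:K" := (of_real s x : K) (at level 2, format "x %:K").

Lemma of_realN : {morph @of_real R s : x / - x}.
Proof. by case: s => //= x; rewrite rmorphN. Qed.

Lemma of_real1 : (1 : R)%:K = 1.
Proof. by case: s. Qed.

Lemma ltr_of_real : {mono @of_real R s : x y / x < y}.
Proof. by move=> x y; rewrite !lt_def ler_of_real (inj_eq of_real_inj). Qed.

Lemma of_real_gt0 (t : R) : (0 < t%:K) = (0 < t).
Proof. by rewrite -of_real0 ltr_of_real. Qed.

(** The real part, used to turn norms, which lie in K, into elements of R. *)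
Definition to_real (k : K) : R :=
  match s return scalar_field R s -> R with
  | RealScalars => id | ComplexScalars => @complex.Re R end k.

Lemma to_realK (k : K) : 0 <= k -> (to_real k)%:K = k.
Proof. by move=> /ge0_of_real[x _ ->]; rewrite /to_real; case: s. Qed.

Section sublinear.
Variable V : lmodType K.
Implicit Types (p q : V -> R) (x y : V).

(** Homogeneity is stated as an inequality, which passes to infima directly;
    rescaling by the inverse gives the equality back ([sublinear_scale]).  Real
    scalars act through their image in K, so that complex spaces need no
    restriction of scalars. *)
Definition sublinear p :=
  (forall x y, p (x + y) <= p x + p y) /\
  (forall (t : R) x, 0 < t -> p (t%:K *: x) <= t * p x).

Lemma sublinear_scale p : sublinear p ->
  forall (t : R) x, 0 < t -> p (t%:K *: x) = t * p x.
Proof.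
move=> [_ pZ] t x t0; apply/eqP; rewrite eq_le pZ//= mulrC -ler_pdivlMr//.
have := pZ t^-1 (t%:K *: x); rewrite invr_gt0 scalerA -of_realM mulVf ?gt_eqF//.
by rewrite of_real1 scale1r mulrC; exact.
Qed.

Lemma sublinear_ge p q x : sublinear q -> (forall y, q y <= p y) ->
  - p (- x) <= q x.
Proof.
move=> [qD _] qp; have := qD x (- x); have := qD 0 0; have := qp (- x).
by rewrite addr0 subrr; lra.
Qed.

(** Subadditivity survives an infimum only because the family is a chain: of q
    and r, the smaller one bounds the value at x + y by q x + r y. *)
Lemma sublinear_inf p (Q : set (V -> R)) : Q p ->
    (forall q, Q q -> sublinear q) -> (forall q x, Q q -> q x <= p x) ->
    total_on Q (fun q r => forall x, r x <= q x) ->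
  let m x := inf [set q x | q in Q] in
  sublinear m /\ forall q x, Q q -> m x <= q x.
Proof.
move=> Qp Qsub Qle Qtot m.
have mle q x : Q q -> m x <= q x.
  move=> Qq; apply: ge_inf; last by exists q.
  exists (- p (- x)) => _ [r Qr <-]; apply: sublinear_ge; first exact: Qsub.
  by move=> y; exact: Qle.
have lem x (r : R) : (forall q, Q q -> r <= q x) -> r <= m x.
  move=> rq; apply: lb_le_inf; first by exists (p x), p.
  by move=> _ [q Qq <-]; exact: rq.
split => //; split => [x y|t x t0].
  rewrite -lerBlDr; apply: (lem) => q Qq; rewrite lerBlDr -lerBlDl.
  apply: (lem) => r Qr; rewrite lerBlDl.
  have [rq|qr] := Qtot _ _ Qq Qr.
    apply: le_trans (mle _ _ Qr) _; have [rD _] := Qsub _ Qr.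
    by rewrite (le_trans (rD _ _))// lerD2r.
  apply: le_trans (mle _ _ Qq) _; have [qD _] := Qsub _ Qq.
  by rewrite (le_trans (qD _ _))// lerD2l.
rewrite mulrC -ler_pdivrMr//; apply: (lem) => q Qq.
rewrite ler_pdivrMr// mulrC; apply: le_trans (mle _ _ Qq) _.
by have [_ ->] := Qsub _ Qq.
Qed.

Lemma exists_minimal_sublinear p : sublinear p ->
  exists q, [/\ sublinear q, forall x, q x <= p x &
    forall r, sublinear r -> (forall x, r x <= q x) -> forall x, q x <= r x].
Proof.
move=> psub; pose P q := sublinear q /\ forall x, q x <= p x.
pose T := {q : V -> R | P q}.
pose leT (q r : T) := `[< forall x, sval r x <= sval q x >].
have pT : P p by split.
have [|||q qmin] := @ZL_preorder T (exist P p pT) leT.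
- by move=> q; apply/asboolP.
- move=> q r t /asboolP qr /asboolP rt; apply/asboolP => x.
  exact: le_trans (qr x).
- move=> C Ctot; pose Q := p |` [set sval q | q in C].
  have [|||| msub mle] := @sublinear_inf p Q.
  + by left.
  + by move=> _ [->//|[q _ <-]]; have [] := svalP q.
  + by move=> _ x [->//|[q _ <-]]; have [_ ->] := svalP q.
  + move=> _ _ [->|[q Cq <-]] [->|[r Cr <-]].
    * by left.
    * by left; have [] := svalP r.
    * by right; have [] := svalP q.
    * by have [/asboolP|/asboolP] := Ctot _ _ Cq Cr; [left|right].
  have mT : P (fun x => inf [set q x | q in Q]).
    by split=> // x; apply: mle; left.
  exists (exist P _ mT) => q Cq; apply/asboolP => x /=.
  by apply: mle; right; exists q.
exists (sval q); have [qsub qp] := svalP q; split=> // r rsub rq x.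
have rT : P r.
  by split=> // y; exact: le_trans (qp y).
by have /asboolP := qmin (exist P r rT) (asboolT rq); exact.
Qed.

(** The largest sublinear minorant of p that satisfies f (- y) <= - p y, hence
    that is linear along y. *)
Definition directional p y x : R :=
  inf [set p (x + t%:K *: y) - t * p y | t in [set t : R | 0 <= t]].

Lemma directional_le p y : sublinear p -> forall (t : R) x, 0 <= t ->
  directional p y x <= p (x + t%:K *: y) - t * p y.
Proof.
move=> psub t x t0; apply: ge_inf; last by exists t.
exists (- p (- x)) => _ [r /= r0 <-].
have [pD _] := psub; have := pD (- x) (x + r%:K *: y); rewrite addKr.
have /predU1P[<-|{}r0] : (0 == r) || (0 < r) by rewrite -le_eqVlt.
  rewrite of_real0 scale0r addr0 mul0r subr0 => _.
  exact: sublinear_ge.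
by rewrite (sublinear_scale psub)//; lra.
Qed.

Lemma directional_sublinear p y : sublinear p -> sublinear (directional p y).
Proof.
move=> psub; have [pD pZ] := psub.
have lem x (r : R) :
    (forall t, 0 <= t -> r <= p (x + t%:K *: y) - t * p y) ->
    r <= directional p y x.
  move=> rq; apply: lb_le_inf; last by move=> _ [t t0 <-]; exact: rq.
  by exists (p (x + 0%:K *: y) - 0 * p y), 0 => /=.
split => [x x'|t x t0].
  rewrite -lerBlDr; apply: (lem) => t t0; rewrite lerBlDr -lerBlDl.
  apply: (lem) => t' t'0.
  have := directional_le y psub (x + x') (addr_ge0 t0 t'0).
  rewrite of_realD scalerDl addrACA.
  by have := pD (x + t%:K *: y) (x' + t'%:K *: y); lra.
rewrite mulrC -ler_pdivrMr//; apply: (lem) => r r0; rewrite ler_pdivrMr//.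
have := directional_le y psub (t%:K *: x) (mulr_ge0 (ltW t0) r0).
rewrite of_realM -scalerA -scalerDr => /le_trans; apply.
by rewrite (sublinear_scale psub)// mulrBl [r * _ * t]mulrC mulrA [_ * t]mulrC.
Qed.

(** By minimality q is below its own directional minorant along y, whose value
    at x is at most q (x + y) - q y (take t = 1). *)
Lemma minimal_sublinear_additive q : sublinear q ->
    (forall r, sublinear r -> (forall x, r x <= q x) ->
      forall x, q x <= r x) ->
  forall x y, q (x + y) = q x + q y.
Proof.
move=> qsub qmin x y; apply/eqP; rewrite eq_le; have [-> _] := qsub.
have := qmin _ (directional_sublinear y qsub); move=> /(_ _ x) qdir /=.
rewrite -lerBrDr (le_trans (qdir _))// => [z|].
  have := directional_le y qsub z (lexx 0).
  by rewrite of_real0 scale0r addr0 mul0r subr0.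
by have := directional_le y qsub x ler01; rewrite of_real1 scale1r mul1r.
Qed.

(** A minimal functional is taken below the directional minorant of p along x0,
    rather than below p, in order to force u (- x0) <= - p x0. *)
Theorem hahn_banach_sublinear p x0 : sublinear p ->
  exists u : V -> R,
    [/\ forall x y, u (x + y) = u x + u y,
        forall (t : R) x, u (t%:K *: x) = t * u x,
        forall x, u x <= p x & u x0 = p x0].
Proof.
move=> psub.
have [u [usub udir umin]] :=
  exists_minimal_sublinear (directional_sublinear x0 psub).
have uD := minimal_sublinear_additive usub umin.
have u0 : u 0 = 0 by have := uD 0 0; rewrite addr0; lra.
have uN x : u (- x) = - u x by have := uD x (- x); rewrite subrr u0; lra.
have up x : u x <= p x.
  apply: le_trans (udir x) _; have := directional_le x0 psub x (lexx 0).
  by rewrite of_real0 scale0r addr0 mul0r subr0.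
exists u; split=> // [t x|].
  have [t0|t0|->] := ltrgt0P t.
  - exact: sublinear_scale.
  - rewrite -[t]opprK of_realN scaleNr uN (sublinear_scale usub) ?oppr_gt0//.
    by rewrite !mulNr.
  - by rewrite of_real0 scale0r u0 mul0r.
apply/eqP; rewrite eq_le up/=.
have := directional_le x0 psub (- x0) ler01.
rewrite of_real1 scale1r addNr mul1r.
have := udir (- x0); rewrite uN.
by have := sublinear_scale psub 0 (ltr0n _ 2); rewrite scaler0; lra.
Qed.

End sublinear.
End hahn_banach.

(** * Bounded functionals measuring the distance to a subspace *)

Section dual_separation.
Context {R : realType} {s : scalars}.
Local Notation K := (scalar_field R s).
Local Notation "x %:K" := (of_real s x : K) (at level 2, format "x %:K").

(** Over the complex numbers f x = u x - i u (i x).  The bound on |f x| follows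
    from the one on u by rotating x so that f x becomes a nonnegative real. *)
Lemma exists_linear_real_part (V : lmodType K) (p u : V -> R) :
    (forall x y, u (x + y) = u x + u y) ->
    (forall (t : R) x, u (t%:K *: x) = t * u x) ->
    (forall x, u x <= p x) ->
    (forall (k : K) x, (p (k *: x))%:K = `|k| * (p x)%:K) ->
  exists f : V -> K^o,
    [/\ linear f, forall x, to_real (f x) = u x &
        forall x, `|f x| <= (p x)%:K].
Proof.
case: s V p u => /= V p u uD uZ up pZ.
  exists u; split=> // [k x y|x]; first by rewrite uD uZ.
  rewrite ler_norml up andbT lerNl.
  have -> : - u x = u ((- 1) *: x) by rewrite uZ mulN1r.
  by rewrite (le_trans (up _))// pZ normrN normr1 mul1r.
pose f x : R[i] := Complex (u x) (- u ('i%C *: x)).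
have uC (a b : R) x : u (Complex a b *: x) = a * u x + b * u ('i%C *: x).
  rewrite -(uZ a) -(uZ b) -uD scalerA -scalerDl; congr (u (_ *: _)).
  by rewrite [LHS]complexE /= mulrC.
have fZ (k : R[i]) x : f (k *: x) = k * f x.
  case: k => a b; rewrite /f scalerA.
  have -> : ('i%C * Complex a b)%R = Complex (- b) a :> R[i].
    by rewrite /GRing.mul/= !mul0r !mul1r sub0r add0r.
  rewrite (uC a b) (uC (- b) a); move: (u x) (u _) => v w.
  by apply/eqP; rewrite eq_complex/=; apply/andP; split; apply/eqP; lra.
have fD x y : f (x + y) = f x + f y.
  by rewrite /f scalerDr !uD opprD.
have p_ge0 x : 0 <= p x.
  have := up x; have := up ((-1)%:C%C *: x); rewrite uZ.
  have : p ((-1)%:C%C *: x) = p x.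
    rewrite (_ : (-1)%:C%C = -1 :> R[i]); last by rewrite rmorphN1.
    by have := pZ (-1) x; rewrite normrN normr1 mul1r => -[->].
  by move=> ->; lra.
have fle x : `|f x| <= (p x)%:C%C.
  have [->|fx0] := eqVneq (f x) 0; first by rewrite normr0 ler0c.
  pose k := `|f x| / f x.
  have nk : `|k| = 1 by rewrite normf_div normr_id divff// normr_eq0.
  have -> : (p x)%:C%C = (p (k *: x))%:C%C by rewrite pZ nk mul1r.
  have kx : f (k *: x) = `|f x| by rewrite fZ divfK.
  have -> : `|f x| = (u (k *: x))%:C%C.
    by rewrite -(RRe_real (normr_real (f x))) -kx.
  by rewrite lecR.
by exists f; split=> // k x y; rewrite fD fZ.
Qed.

Variable V : normedModType K.

Definition dist (W : set V) (x : V) : R :=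
  inf [set to_real `|x - w| | w in W].

Lemma dist_le W x w : W w -> (dist W x)%:K <= `|x - w|.
Proof.
move=> Ww; rewrite -[leRHS]to_realK// ler_of_real.
apply: ge_inf; last by exists w.
exists 0 => _ [v Wv <-]; rewrite -(ler_of_real (s := s)) of_real0.
by rewrite to_realK.
Qed.

Lemma le_dist W x (r : R) : W !=set0 ->
  (forall w, W w -> r%:K <= `|x - w|) -> r <= dist W x.
Proof.
move=> [w0 Ww0] rW; apply: lb_le_inf; first by exists (to_real `|x - w0|), w0.
by move=> _ [w Ww <-]; rewrite -(ler_of_real (s := s)) to_realK// rW.
Qed.

Variable W : set V.
Hypotheses (W0 : W 0) (WD : forall (k : K) x y, W x -> W y -> W (k *: x + y)).

Let Wn0 : W !=set0. Proof. by exists 0. Qed.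

Lemma dist_ge0 x : 0 <= dist W x.
Proof. by apply: le_dist => // w _; rewrite of_real0. Qed.

Lemma distD x y : dist W (x + y) <= dist W x + dist W y.
Proof.
rewrite -lerBlDr; apply: le_dist => // w Ww.
rewrite -[leRHS]to_realK// ler_of_real lerBlDr -lerBlDl.
apply: le_dist => // v Wv.
rewrite -[leRHS]to_realK// ler_of_real lerBlDl.
rewrite -(ler_of_real (s := s)) of_realD !to_realK//.
apply: le_trans (ler_normD _ _); rewrite addrACA -opprD; apply: dist_le.
by rewrite -[w]scale1r; apply: WD.
Qed.

Lemma distZ (k : K) x : (dist W (k *: x))%:K = `|k| * (dist W x)%:K.
Proof.
have le_distZ (l : K) y : (dist W (l *: y))%:K <= `|l| * (dist W y)%:K.
  have [->|l0] := eqVneq l 0.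
    rewrite normr0 mul0r scale0r; apply: le_trans (dist_le 0 W0) _.
    by rewrite subrr normr0.
  have [r _ rE] := ge0_of_real (normr_ge0 l).
  have r0 : 0 < r by rewrite -(of_real_gt0 (s := s)) -rE normr_gt0.
  rewrite rE -of_realM ler_of_real mulrC -ler_pdivrMr//.
  apply: le_dist => // w Ww.
  rewrite -[leRHS]to_realK// ler_of_real ler_pdivrMr// mulrC.
  rewrite -(ler_of_real (s := s)) of_realM to_realK// -rE -normrZ scalerBr.
  by apply: dist_le; rewrite -[_ *: w]addr0; exact: WD.
apply/eqP; rewrite eq_le le_distZ/=.
have [->|k0] := eqVneq k 0.
  by rewrite normr0 mul0r -of_real0 ler_of_real dist_ge0.
by rewrite -ler_pdivlMl ?normr_gt0// -{1}[x](scalerK k0) -normfV le_distZ.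
Qed.

Lemma to_real_norm_eq (k : K) (r : R) :
  `|k| <= r%:K -> to_real k = r -> k = r%:K.
Proof.
rewrite /to_real; case: s k => //= -[a b] abr ar.
move: abr; rewrite -{}ar normc_def lecR /= => ab; congr Complex; apply/eqP.
have a0 : 0 <= a := le_trans (sqrtr_ge0 _) ab.
move: ab; rewrite -[leRHS](ger0_norm a0) -sqrtr_sqr.
rewrite ler_sqrt ?sqr_ge0// gerDl => b0.
by rewrite -sqrf_eq0 eq_le b0 sqr_ge0.
Qed.

(** The distance to W is a seminorm that vanishes on W and is at most the norm,
    so a functional dominated by it has both required properties. *)
Lemma exists_dual_dist x :
  exists f : dual V, [/\ forall w, W w -> f w = 0, `|f| <= 1 &
    f x = (dist W x)%:K].
Proof.
have dsub : sublinear (dist W).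
  split=> [y z|t y t0]; first exact: distD.
  rewrite -(ler_of_real (s := s)) distZ of_realM ger0_norm//.
  by rewrite ltW// of_real_gt0.
have [u [uD uZ up ux]] := hahn_banach_sublinear x dsub.
have [f [lf fu fp]] := exists_linear_real_part uD uZ up distZ.
have fle y : `|f y| <= 1 * `|y|.
  rewrite mul1r (le_trans (fp y))// -[y in leRHS]subr0; exact: dist_le.
have fP : f \in @continuous_linear_functional R s V.
  by apply: bounded_dual => //; exists 1.
exists (Dual fP); split=> /= [w Ww||].
- apply/eqP; rewrite -normr_le0 (le_trans (fp w))//.
  by apply: le_trans (dist_le w Ww) _; rewrite subrr normr0.
- exact: norm_dual_le.
- by apply: to_real_norm_eq; [exact: fp|rewrite fu ux].
Qed.

End dual_separation.

(** * The canonical embedding is isometric with closed range *)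

Section embedding.
Context {R : realType} {s : scalars}.
Local Notation K := (scalar_field R s).
Local Notation "x %:K" := (of_real s x : K) (at level 2, format "x %:K").

Lemma canonical_embeddingP (V : normedModType K) (k : K) (x y : V) :
  canonical_embedding (k *: x + y) =
    k *: canonical_embedding x + canonical_embedding y.
Proof. by apply: dual_eqP => f; rewrite dualDE dualZE /= linearP. Qed.

Lemma canonical_embeddingB (V : normedModType K) (x y : V) :
  canonical_embedding (x - y) = canonical_embedding x - canonical_embedding y.
Proof. by rewrite addrC -scaleN1r canonical_embeddingP scaleN1r addrC. Qed.

(** Norming functionals come from the distance to the zero subspace. *)
Lemma norm_canonical_embedding (V : normedModType K) (x : V) :
  `|canonical_embedding x| = `|x|.
Proof.
apply/eqP; rewrite eq_le; apply/andP; split.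
  by apply: norm_dual_le => // f; rewrite mulrC; exact: (ler_norm_dual f x).
have [|k _ _ -> ->|f [_ f1 fx]] := @exists_dual_dist R s V [set 0] _ _ x.
- by [].
- by rewrite scaler0 addr0.
have xd : `|x| <= `|f x|.
  have [r r0 rE] := ge0_of_real (normr_ge0 x).
  have rd : r <= dist [set 0] x.
    by apply: le_dist => [|_ ->]; [exists 0|rewrite subr0 rE].
  have d0 : 0 <= (dist [set 0] x)%:K.
    by rewrite -of_real0 ler_of_real (le_trans r0).
  by rewrite fx (ger0_norm d0) rE ler_of_real.
apply: le_trans xd _; have := ler_norm_dual (canonical_embedding x) f => /=.
by move=> /le_trans; apply; rewrite ler_piMr.
Qed.

(** The sets of vectors whose image is r-close to F generate a filter on V; it
    is Cauchy because the embedding is isometric, and its limit is mapped to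
    F. *)
Lemma dist_canonical_embedding_eq0 (V : completeNormedModType K)
    (F : dual (dual V)) :
  dist (range (@canonical_embedding R s V)) F = 0 ->
  range (@canonical_embedding R s V) F.
Proof.
move=> F0.
pose B (r : R) := [set x : V | `|F - canonical_embedding x| < r%:K].
have B0 r : 0 < r -> B r !=set0.
  rewrite -F0 /dist => /inf_lt[|_ [_ [x _ <-] <-]].
    by exists (to_real `|F - canonical_embedding 0|), (canonical_embedding 0).
  rewrite -(ltr_of_real (s := s)) to_realK// => Fx.
  by exists x.
have B_half r x y : B (r / 2) x -> B (r / 2) y -> `|x - y| < r%:K.
  move=> Bx By; rewrite -norm_canonical_embedding canonical_embeddingB.
  rewrite -(subrKA F) (splitr r) of_realD.
  by rewrite (le_lt_trans (ler_normD _ _))// ltrD// distrC.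
pose G := filter_from [set r : R | 0 < r] B.
have GF : ProperFilter G.
  apply: filter_from_proper; last by move=> r; exact: B0.
  apply: filter_from_filter; first by exists 1 => /=.
  move=> r1 r2 /= r10 r20; exists (Num.min r1 r2); first by rewrite lt_min r10.
  move=> x; rewrite /B /= => Bx; split; apply: lt_le_trans Bx _.
    by rewrite ler_of_real ge_min lexx.
  by rewrite ler_of_real ge_min lexx orbT.
have Gcauchy : cauchy G.
  apply: cauchy_exP => e e0; have [r _ re] := ge0_of_real (ltW e0).
  have r2 : 0 < r / 2 by rewrite divr_gt0// -(of_real_gt0 (s := s)) -re.
  have [x Bx] := B0 _ r2; exists x, (r / 2) => // y By.
  by rewrite -ball_normE /= re B_half.
have /cauchy_cvg/cvg_ex[/= x Gx] := Gcauchy.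
exists x => //; apply/esym/eqP; rewrite -subr_eq0 -normr_eq0.
apply/negP => /negP Fx.
have [r _ re] := ge0_of_real (normr_ge0 (F - canonical_embedding x)).
have r2 : 0 < r / 2.
  by rewrite divr_gt0// -(of_real_gt0 (s := s)) -re lt_def Fx normr_ge0.
have Gball : G (ball x (r / 2)%:K).
  by apply: Gx; apply: nbhsx_ballx; rewrite of_real_gt0.
have GB : G (B (r / 2)) by exists (r / 2).
have [y [By]] := filter_ex (filterI GB Gball).
rewrite -ball_normE /= distrC -norm_canonical_embedding canonical_embeddingB.
move=> xy.
have := le_lt_trans (ler_distD (canonical_embedding y) _ _) (ltrD By xy).
by rewrite re -(of_realD (r / 2)) -splitr ltxx.
Qed.

End embedding.

(** * Weak* density of a space in its bidual *)

Section density.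
Context {R : realType} {s : scalars}.
Local Notation K := (scalar_field R s).
Variable V : normedModType K.

(** The conclusion covers all functionals vanishing on the common kernel of fs,
    i.e., the span of fs.  This makes the induction work without any linear
    algebra: a new functional f either vanishes on the common kernel of the
    previous ones, and x need not change, or takes the value 1 at some z of that
    kernel, and moving x along z corrects the value at f and keeps those at fs. *)
Lemma bidual_interpolation_strong (F : dual (dual V)) (fs : seq (dual V)) :
  exists x : V, forall g : dual V,
    (forall y, (forall f, f \in fs -> f y = 0) -> g y = 0) -> g x = F g.
Proof.
elim: fs => [|f fs [x xF]].
  exists 0 => g g0; have -> : g = 0 by apply: dual_eqP => y; exact: g0.
  by rewrite !linear0.
have [[z [zfs fz]]|nz] :=
    pselect (exists z : V, (forall h, h \in fs -> h z = 0) /\ f z = 1).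
  exists (x + (F f - f x) *: z) => g g0.
  (* subtracting this multiple of f makes g vanish on the kernel of fs *)
  pose h := (- g z) *: f + g.
  have hE y : h y = - g z * f y + g y by [].
  have hx : h x = F h.
    apply: xF => y yfs; rewrite hE.
    have : g (y - f y *: z) = 0.
      apply: g0 => k; rewrite inE linearB linearZ/= => /predU1P[->|kfs].
        by rewrite fz -[f y *: _]/(f y * 1) mulr1 subrr.
      by rewrite yfs// zfs// scaler0 subrr.
    by rewrite linearB linearZ/= mulNr mulrC addrC => <-.
  move: hx; rewrite hE linearP => /(canRL (addKr _)) gx.
  have E (a b c d : K) : - (- a * b) + (- a * c + d) + (c - b) * a = d by ring.
  by rewrite linearD linearZ/= gx; exact: E.
exists x => g g0; apply: xF => y yfs; apply: g0 => h.
rewrite inE => /predU1P[->|/yfs//]; apply/eqP; apply: contrapT => /negP fy.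
by case: nz; exists ((f y)^-1 *: y); split=> [k /yfs ky|];
  rewrite linearZ/= ?ky ?scaler0//; exact: mulVf.
Qed.

Lemma bidual_interpolation (F : dual (dual V)) (fs : seq (dual V)) :
  exists x : V, forall f, f \in fs -> f x = F f.
Proof.
have [x xF] := bidual_interpolation_strong F fs.
by exists x => f ffs; apply: xF => y; exact.
Qed.

Lemma cvg_initial_topology (S : choiceType) (T : topologicalType) (h : S -> T)
    (G : set_system S) (FG : Filter G) (x : S) :
  h @ G --> h x -> G --> (x : initial_topology h).
Proof.
move=> hG A; rewrite (@nbhsE (initial_topology h)).
move=> [_ [[B Bop <-] Bx] BA]; apply: filterS BA _.
by apply: (hG B); exact: open_nbhs_nbhs.
Qed.

(** Vectors interpolating F over larger and larger finite sets of functionals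
    form a filter that converges to F in the weak* topology. *)
Lemma wstar_continuous_eq0 (phi : weak_star (dual V) -> K^o) :
    continuous phi ->
    (forall x : V, phi (canonical_embedding x) = 0) ->
  forall F, phi F = 0.
Proof.
move=> phic phi0 F.
pose G := filter_from [set: seq (dual V)]
  (fun fs => [set x : V | forall f, f \in fs -> f x = F f]).
have GF : ProperFilter G.
  apply: filter_from_proper => [|fs _].
    apply: filter_from_filter => [|fs gs _ _]; first by exists [::].
    exists (fs ++ gs) => // x xF; split=> f ffs; apply: xF;
      by rewrite mem_cat ffs ?orbT.
  exact: bidual_interpolation.
have GcvgF : @canonical_embedding R s V @ G --> (F : weak_star (dual V)).
  apply: cvg_initial_topology; apply/pointwise_cvgP => f.
  apply: cvg_near_cst; exists [:: f] => // x; apply.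
  by rewrite mem_head.
have phiG : phi \o @canonical_embedding R s V @ G --> phi F.
  exact: cvg_comp GcvgF (phic F).
apply: (cvg_unique (@norm_hausdorff _ K^o) phiG).
apply: cvg_near_cst; apply: nearW => x; exact: phi0.
Qed.
End density.

(** * Weak*-to-weak continuous maps preserving A *)

Section main.
Context {R : realType} {s : scalars}.
Local Notation K := (scalar_field R s).
Variable A : banachAlgType K.

Lemma is_subspace_embedded : is_subspace (embedded A).
Proof.
split; first by exists 0 => //; apply: dual_eqP => f; rewrite /= linear0.
move=> k _ _ [x _ <-] [y _ <-]; exists (k *: x + y) => //.
exact: canonical_embeddingP.
Qed.

Lemma arens_canonical_embedding (a b : A) :
  arens (canonical_embedding a) (canonical_embedding b) =
    canonical_embedding (bmul a b).
Proof. exact: dual_eqP. Qed.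

(** Let phi vanish on A and take at T F the value of the distance from T F to A.
    Then phi o T is weak*-continuous and vanishes on A, so this distance is
    zero. *)
Lemma wstar_weak_into_embedded (T : dual (dual A) -> dual (dual A)) :
    wstar_to_weak_continuous T ->
    (forall a : A, embedded A (T (canonical_embedding a))) ->
  forall F, embedded A (T F).
Proof.
move=> Tc TA F; apply: dist_canonical_embedding_eq0.
have [W0 WD] := is_subspace_embedded.
have [phi [phi0 _ phid]] := exists_dual_dist W0 WD (T F).
apply: (@of_real_inj _ s); rewrite -[LHS]phid of_real0.
apply: (@wstar_continuous_eq0 _ _ A (fun G => phi (T G))) => [G|a]; last first.
  by apply: phi0; exact: TA.
have /pointwise_cvgP := cvg_comp _ _ (Tc G) (@initial_continuous _ _ _ (T G)).
move=> cvgT; apply: (cvgT _ phi).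
by do 2 apply: fmap_filter; exact: (nbhs_filter G).
Qed.

End main.

Theorem mainTheorem2 (R : realType) (s : scalars)
    (A : banachAlgType (scalar_field R s)) :
  (left_wstar_weak_center A = embedded A -> is_right_ideal (embedded A)) /\
  (right_wstar_weak_center A = embedded A -> is_left_ideal (embedded A)) /\
  (left_wstar_weak_center A = embedded A ->
   right_wstar_weak_center A = embedded A -> is_ideal (embedded A)).
Proof.
have right : left_wstar_weak_center A = embedded A ->
    is_right_ideal (embedded A).
  move=> ZA; split=> [|F G AF]; first exact: is_subspace_embedded.
  have Fc : left_wstar_weak_center A F by rewrite ZA.
  apply: (wstar_weak_into_embedded Fc) => b.
  have [a _ <-] := AF; exists (bmul a b) => //.
  by rewrite arens_canonical_embedding.
have left : right_wstar_weak_center A = embedded A ->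
    is_left_ideal (embedded A).
  move=> ZA; split=> [|F G AF]; first exact: is_subspace_embedded.
  have Fc : right_wstar_weak_center A F by rewrite ZA.
  apply: (wstar_weak_into_embedded Fc) => b.
  have [a _ <-] := AF; exists (bmul b a) => //.
  by rewrite arens_canonical_embedding.
by split=> //; split=> // Zl Zr; split; [exact: left|exact: right].
Qed.
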